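(* Let $B,\bar B$ be real or complex vector spaces and $L(\varepsilon)=\sum_{i=0}^\infty\varepsilon^iL_i$ a formal power series with $L_i\in L(B,\bar B)$, $L(\varepsilon)\not\equiv0$. Run the recursion of the context with some choice of complements. Then for every $k\ge0$ the following identities of operator row vectors (linear maps $B^{k+1}\to\bar B$) hold: $$(L_0\ \cdots\ L_k)\cdot M^{(k+1)}=(\bar S_1\ \cdots\ \bar S_{k+1})\cdot E^{(k+1)}=(S_1\ \cdots\ S_{k+1}).$$
   Context: $L(X,Y)$ denotes the linear maps from $X$ to $Y$; $I_X$ is the identity. Recursion. Put $N_0:=B$, $N_0^c:=\{0\}$, $R_0:=\{0\}$, $R_0^c:=\bar B$, $\bar S_1:=S_1:=L_0$, $E_{1,1}:=M_{1,1}:=I_B$. At each stage $j\ge1$, given $S_j\in L(B,R_{j-1}^c)$, set $N_j:=\{n\in N_{j-1}\mid S_jn=0\}$, $R_j:=S_j(N_{j-1})$ and choose algebraic direct complements $N_{j-1}=N_j^c\oplus N_j$, $R_{j-1}^c=R_j\oplus R_j^c$. Then $B=N_1^c\oplus\cdots\oplus N_j^c\oplus N_j$ and $\bar B=R_1\oplus\cdots\oplus R_j\oplus R_j^c$; $\mathcal P_j$ denotes the projection of $\bar B$ onto $R_j$ defined by the latter decomposition, and $S_j^{-1}:R_j\to N_j^c$ denotes the inverse of the bijection $S_j|_{N_j^c}:N_j^c\to R_j$. At stage $j\ge2$, the operators are defined by $$\bar S_j:=\sum_{i=1}^{j-1}L_iM_{i,j-1},\qquad S_j:=(I_{\bar B}-\mathcal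 P_1-\cdots-\mathcal P_{j-1})\bar S_j,$$ $$E_{j,j}:=I_B,\qquad E_{i,j}:=-S_i^{-1}\mathcal P_i\sum_{\nu=i+1}^{j}\bar S_\nu E_{\nu,j}\quad (i=j-1,\dots,1),$$ $$M_{1,j}:=E_{1,j},\qquad M_{i,j}:=\sum_{\nu=i}^{j}M_{i-1,\nu-1}E_{\nu,j}\quad(i=2,\dots,j).$$ (So $M_{j,j}=I_B$.) $E^{(k+1)}$ and $M^{(k+1)}$ are the upper triangular $(k+1)\times(k+1)$ operator matrices with entries $E_{i,j}$, respectively $M_{i,j}$, for $i\le j$ and $0$ for $i>j$. *)

(* Defs.v *)
From mathcomp Require Import all_boot all_order all_algebra.
From mathcomp Require Import boolp classical_sets functions reals.
From mathcomp Require Import complex.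

Set Implicit Arguments.
Unset Strict Implicit.
Unset Printing Implicit Defensive.

Import GRing.Theory.
Local Open Scope classical_set_scope.
Local Open Scope ring_scope.

Inductive scalar_kind := Real | Complex.

Definition scalars (F : realType) (kind : scalar_kind) : fieldType :=
  match kind with Real => F | Complex => F[i] end.

(* W = A (+) C, algebraically; the spaces may be infinite-dimensional, so
   subspaces are Prop-valued sets. *)
Definition direct_sum (K : fieldType) (V : lmodType K) (W A C : set V) : Prop :=
  [/\ GRing.submod_closed (mem A), GRing.submod_closed (mem C),
      A `&` C = [set 0] & W = [set a + c | a in A & c in C]].

(* Operators are plain functions, added pointwise (zmodType structure of
   functions). Linearity of S_, Sbar_, P_, E_ and M_ is not assumed: the fields
   determine these operators from L and the chosen complements Nc_, Rc_, and
   their linearity follows. Indices are 1-based stages; values at indices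
   not mentioned in the fields play no role. *)
Record recursion (K : fieldType) (B Bbar : lmodType K)
    (L : nat -> {linear B -> Bbar}) := Recursion {
  N_ : nat -> set B;
  Nc_ : nat -> set B;
  R_ : nat -> set Bbar;
  Rc_ : nat -> set Bbar;
  S_ : nat -> B -> Bbar;
  Sbar_ : nat -> B -> Bbar;
  (* inverse of S_ j : Nc_ j -> R_ j, with arbitrary values off R_ j *)
  Sinv_ : nat -> Bbar -> B;
  P_ : nat -> Bbar -> Bbar;
  E_ : nat -> nat -> B -> B;
  M_ : nat -> nat -> B -> B;

  N_init : N_ 0 = setT;
  Nc_init : Nc_ 0 = [set 0];
  R_init : R_ 0 = [set 0];
  Rc_init : Rc_ 0 = setT;
  Sbar_init : Sbar_ 1 = L 0;
  S_init : S_ 1 = L 0;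

  N_rec : forall j, (1 <= j)%N ->
    N_ j = [set n | N_ j.-1 n /\ S_ j n = 0];
  R_rec : forall j, (1 <= j)%N ->
    R_ j = [set S_ j n | n in N_ j.-1];
  Nc_compl : forall j, (1 <= j)%N -> direct_sum (N_ j.-1) (Nc_ j) (N_ j);
  Rc_compl : forall j, (1 <= j)%N -> direct_sum (Rc_ j.-1) (R_ j) (Rc_ j);

  (* projection onto R_ j defined by Bbar = R_ 1 (+) ... (+) R_ j (+) Rc_ j *)
  P_proj : forall j, (1 <= j)%N ->
    forall (r : nat -> Bbar) (c : Bbar),
      (forall i, (1 <= i <= j)%N -> R_ i (r i)) -> Rc_ j c ->
      P_ j (\sum_(1 <= i < j.+1) r i + c) = r j;
  Sinv_inv : forall j, (1 <= j)%N ->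
    forall r, R_ j r -> Nc_ j (Sinv_ j r) /\ S_ j (Sinv_ j r) = r;

  Sbar_rec : forall j, (2 <= j)%N ->
    Sbar_ j = \sum_(1 <= i < j) (L i \o M_ i j.-1);
  S_rec : forall j, (2 <= j)%N ->
    S_ j = ((id : Bbar -> Bbar) - \sum_(1 <= i < j) P_ i) \o Sbar_ j;
  E_diag : forall j, (1 <= j)%N -> E_ j j = id;
  E_rec : forall i j, (1 <= i < j)%N ->
    E_ i j =
      - (Sinv_ i \o P_ i \o \sum_(i.+1 <= v < j.+1) (Sbar_ v \o E_ v j));
  M_first : forall j, (1 <= j)%N -> M_ 1 j = E_ 1 j;
  M_rec : forall i j, (2 <= i <= j)%N ->
    M_ i j = \sum_(i <= v < j.+1) (M_ i.-1 v.-1 \o E_ v j)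
}.

(* Matrix product with composition as multiplication. *)
Definition oprow_mul (U V : zmodType) (n : nat)
    (u : 'rV[U -> V]_n) (A : 'M[U -> U]_n) : 'rV[U -> V]_n :=
  \row_j \sum_i (u 0 i \o A i j).

(* Ordinals are 0-based, the families T below are 1-based. *)
Definition oprow (U V : Type) (n : nat) (T : nat -> U -> V) : 'rV[U -> V]_n :=
  \row_(j < n) T j.+1.

Definition upper_mx (U : zmodType) (n : nat) (T : nat -> nat -> U -> U) :
    'M[U -> U]_n :=
  \matrix_(i, j) if (i <= j)%N then T i.+1 j.+1 else 0.

(* Main.v *)
(* Pulling the sums defining [M i j] through the linear maps [L i] regroups the
   left-hand side into the [Sbar] combination, column by column. For the second
   identity, add the terms [Sbar v (E v j x)] of column [j] in the order
   [v = j, j - 1, ..., 1] and keep track of the partial sum modulo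
   [R 1 + ... + R (i - 1)]: it starts as [Sbar j x], congruent to [S j x], and
   the term [v = i] cancels the [R i]-component that is still present, so that
   only [S j x] is left after the term [v = 1]. *)
Require Import Defs.
From mathcomp Require Import all_boot all_order all_algebra.
From mathcomp Require Import boolp classical_sets functions reals.
Import GRing.Theory.
Set Implicit Arguments.
Unset Strict Implicit.
Unset Printing Implicit Defensive.
Local Open Scope ring_scope.

Lemma zmod_morphism_sum (U V : zmodType) (T : eqType) (s : seq T)
    (P : pred T) (f : T -> U -> V) :
  (forall i, i \in s -> P i -> GRing.zmod_morphism (f i)) ->
  GRing.zmod_morphism (\sum_(i <- s | P i) f i).
Proof.
move=> f_add x y; rewrite !fct_sumE -sumrB big_seq_cond [RHS]big_seq_cond.
by apply: eq_bigr => i /andP[si Pi]; apply: f_add.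
Qed.

Lemma zmod_morphism_comp (U V W : zmodType) (f : V -> W) (g : U -> V) :
  GRing.zmod_morphism f -> GRing.zmod_morphism g ->
  GRing.zmod_morphism (f \o g).
Proof. by move=> f_add g_add x y; rewrite /= g_add f_add. Qed.

Lemma zmod_morphism_opp_fun (U V : zmodType) (f : U -> V) :
  GRing.zmod_morphism f -> GRing.zmod_morphism (- f).
Proof. by move=> f_add x y; rewrite opprfctE f_add opprB opprK addrC. Qed.

Lemma zmod_morphism0 (U V : zmodType) (f : U -> V) :
  GRing.zmod_morphism f -> f 0 = 0.
Proof. by move=> f_add; rewrite -(subr0 0) f_add subrr. Qed.

Lemma zmod_morphismN (U V : zmodType) (f : U -> V) x :
  GRing.zmod_morphism f -> f (- x) = - f x.
Proof. by move=> f_add; rewrite -sub0r f_add zmod_morphism0 // sub0r. Qed.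

Lemma oprow_mul_upper_mx (U V : zmodType) n (u : nat -> U -> V)
    (T : nat -> nat -> U -> U) (j : 'I_n) x :
  (forall i, u i.+1 0 = 0) ->
  oprow_mul (oprow n u) (upper_mx n T) 0 j x =
  \sum_(1 <= i < j.+2) u i (T i j.+1 x).
Proof.
move=> u0; rewrite mxE fct_sumE big_add1 /=.
rewrite big_mkord (big_ord_widen n (fun i => u i.+1 (T i.+1 j.+1 x))) //.
rewrite [RHS]big_mkcond /=; apply: eq_bigr => i _; rewrite !mxE ltnS.
by case: ifP => //= _; apply: u0.
Qed.

Section DirectSum.
Context {K : fieldType} {V : lmodType K} {W A C : set V}.
Hypothesis dsum : direct_sum W A C.

Lemma direct_sum0l : A 0.
Proof. by case: dsum => -[A0 _] _ _ _; move: A0; rewrite inE. Qed.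

Lemma direct_sumBl x y : A x -> A y -> A (x - y).
Proof.
case: dsum => -[_ Alin] _ _ _ Ax Ay.
have := Alin (-1) y x; rewrite !inE scaleN1r addrC; exact.
Qed.

Lemma direct_sumBr x y : C x -> C y -> C (x - y).
Proof.
case: dsum => _ [_ Clin] _ _ Cx Cy.
have := Clin (-1) y x; rewrite !inE scaleN1r addrC; exact.
Qed.

Lemma direct_sumW a c : A a -> C c -> W (a + c).
Proof. by case: dsum => _ _ _ -> Aa Cc; exists a => //; exists c. Qed.

Lemma direct_sum_decomp w : W w -> exists a c, [/\ A a, C c & w = a + c].
Proof. by case: dsum => _ _ _ -> [a Aa [c Cc <-]]; exists a, c. Qed.

Lemma direct_sum_subl a : A a -> W a.
Proof.
move=> Aa; rewrite -(addr0 a); apply: direct_sumW => //.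
by case: dsum => _ [C0 _] _ _; move: C0; rewrite inE.
Qed.

Lemma direct_sum_disjoint x : A x -> C x -> x = 0.
Proof.
case: dsum => _ _ AC _ Ax Cx.
by have : (A `&` C)%classic x by []; rewrite AC.
Qed.

End DirectSum.

Section Recursion.
Context {K : fieldType} {B Bbar : lmodType K} {L : nat -> {linear B -> Bbar}}.
Variable rec : recursion L.

Local Notation R := (R_ rec).
Local Notation Rc := (Rc_ rec).
Local Notation Nc := (Nc_ rec).
Local Notation S := (S_ rec).
Local Notation Sbar := (Sbar_ rec).
Local Notation Sinv := (Sinv_ rec).
Local Notation P := (P_ rec).
Local Notation E := (E_ rec).
Local Notation M := (M_ rec).

Lemma RB j x y : (0 < j)%N -> R j x -> R j y -> R j (x - y).
Proof. by move=> /(Rc_compl rec)/direct_sumBl; apply. Qed.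

Lemma RcB j x y : Rc j x -> Rc j y -> Rc j (x - y).
Proof.
case: j => [|j]; first by rewrite (Rc_init rec).
by move=> Rc_x Rc_y; apply: (direct_sumBr (Rc_compl rec (ltn0Sn j))).
Qed.

Lemma Rbar_decomp n y : exists r c,
  [/\ forall i, (1 <= i <= n)%N -> R i (r i), Rc n c
    & y = \sum_(1 <= i < n.+1) r i + c].
Proof.
elim: n => [|n [r [c [Rr Rc_c ->]]]].
  exists (fun=> 0), y; split; last by rewrite big_geq // add0r.
    by case=> [|i] /andP[].
  by rewrite (Rc_init rec).
have [a [c' [Ra Rc_c' ->]]] := direct_sum_decomp (Rc_compl rec (ltn0Sn n)) Rc_c.
exists (fun i => if i == n.+1 then a else r i), c'; split=> //.
  move=> i /andP[i_gt0]; rewrite leq_eqVlt; case: eqP => [-> //|_ /= i_le].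
  by apply: Rr; rewrite i_gt0.
rewrite [in RHS]big_nat_recr //= eqxx addrA; congr (_ + _ + _).
by apply: eq_big_nat => i /andP[_ i_lt]; rewrite ltn_eqF.
Qed.

Lemma Rc_sum l n r c : (l <= n)%N ->
  (forall i, (l < i <= n)%N -> R i (r i)) -> Rc n c ->
  Rc l (\sum_(l.+1 <= i < n.+1) r i + c).
Proof.
move=> le_ln; elim: n le_ln c => [|n IHn] le_ln c Rr Rc_c.
  by move: le_ln Rc_c; rewrite leqn0 => /eqP ->; rewrite big_geq // add0r.
move: le_ln; rewrite leq_eqVlt ltnS => /predU1P[-> | le_ln].
  by rewrite big_geq // add0r.
rewrite big_nat_recr //= -addrA; apply: IHn => //.
  by move=> i /andP[li i_le]; apply: Rr; rewrite li leqW.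
apply: (direct_sumW (Rc_compl rec (ltn0Sn n))) => //.
by apply: Rr; rewrite ltnS le_ln /=.
Qed.

Lemma Rc_mono l n c : (l <= n)%N -> Rc n c -> Rc l c.
Proof.
move=> le_ln Rc_c.
suff : Rc l (\sum_(l.+1 <= i < n.+1) 0 + c) by rewrite big1 ?add0r.
apply: Rc_sum => // i /andP[lt_li _].
exact: direct_sum0l (Rc_compl rec (leq_trans (ltn0Sn l) lt_li)).
Qed.

Lemma P_sum i n r c : (1 <= i <= n)%N ->
  (forall l, (1 <= l <= n)%N -> R l (r l)) -> Rc n c ->
  P i (\sum_(1 <= l < n.+1) r l + c) = r i.
Proof.
move=> /andP[i_gt0 le_in] Rr Rc_c.
rewrite (big_cat_nat (n := i.+1)) //= -addrA P_proj //.
  by move=> l /andP[l_gt0 le_li]; apply: Rr; rewrite l_gt0 (leq_trans le_li).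
apply: Rc_sum => // l /andP[lt_il le_ln].
by apply: Rr; rewrite le_ln (leq_trans _ lt_il).
Qed.

Lemma P_in_R i y : (0 < i)%N -> R i (P i y).
Proof.
move=> i_gt0; have [r [c [Rr Rc_c ->]]] := Rbar_decomp i y.
by rewrite P_sum ?i_gt0 /= ?leqnn //; apply: Rr; rewrite i_gt0 /=.
Qed.

Lemma P_zmod_morphism i : (0 < i)%N -> GRing.zmod_morphism (P i).
Proof.
move=> i_gt0 x y.
have [r [c [Rr Rc_c ->]]] := Rbar_decomp i x.
have [s [d [Rs Rc_d ->]]] := Rbar_decomp i y.
rewrite opprD addrACA -sumrB !P_sum ?i_gt0 /= ?leqnn //; last exact: RcB.
move=> l /andP[l_gt0 le_li]; apply: RB => //.
  by apply: Rr; rewrite l_gt0.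
by apply: Rs; rewrite l_gt0.
Qed.

Lemma S_E j x : (0 < j)%N ->
  S j x = Sbar j x - (\sum_(1 <= i < j) P i) (Sbar j x).
Proof.
case: j => // -[_|j _]; last by rewrite S_rec.
by rewrite big_geq // S_init Sbar_init subr0.
Qed.

Lemma Sbar_split j x : (0 < j)%N ->
  Sbar j x = S j x + \sum_(1 <= i < j) P i (Sbar j x).
Proof. by move=> j_gt0; rewrite S_E // fct_sumE subrK. Qed.

Lemma S_in_Rc j x : (0 < j)%N -> Rc j.-1 (S j x).
Proof.
case: j => // j _; have [r [c [Rr Rc_c Sbar_x]]] := Rbar_decomp j (Sbar j.+1 x).
suff -> : S j.+1 x = c by [].
apply: (addIr (\sum_(1 <= i < j.+1) r i)); rewrite [RHS]addrC -Sbar_x.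
rewrite [RHS]Sbar_split //; congr (_ + _); rewrite Sbar_x.
by apply: eq_big_nat => i i_bd; rewrite P_sum.
Qed.

Lemma S_zmod_morphism j : (0 < j)%N ->
  GRing.zmod_morphism (Sbar j) -> GRing.zmod_morphism (S j).
Proof.
move=> j_gt0 Sbar_add x y.
have P_add : GRing.zmod_morphism (\sum_(1 <= i < j) P i).
  apply: zmod_morphism_sum => i; rewrite mem_index_iota => /andP[i_gt0 _] _.
  exact: P_zmod_morphism.
by rewrite !S_E // Sbar_add P_add !opprB addrACA [in RHS]addrACA [- _ + _]addrC.
Qed.

Lemma SinvP_zmod_morphism j : (0 < j)%N ->
  GRing.zmod_morphism (S j) -> GRing.zmod_morphism (Sinv j \o P j).
Proof.
move=> j_gt0 S_add x y /=.
have SinvP z : Nc j (Sinv j (P j z)) /\ S j (Sinv j (P j z)) = P j z.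
  by apply: Sinv_inv => //; apply: P_in_R.
have Nc_ds := Nc_compl rec j_gt0.
have Nc_xy : Nc j (Sinv j (P j (x - y)) - (Sinv j (P j x) - Sinv j (P j y))).
  apply: (direct_sumBl Nc_ds); first by case: (SinvP (x - y)).
  by apply: (direct_sumBl Nc_ds); [case: (SinvP x) | case: (SinvP y)].
apply/eqP; rewrite -subr_eq0; apply/eqP.
apply: (direct_sum_disjoint Nc_ds Nc_xy).
rewrite (N_rec rec j_gt0); split; first exact: (direct_sum_subl Nc_ds).
by rewrite !S_add !(SinvP _).2 P_zmod_morphism // subrr.
Qed.

Lemma E_zmod_morphism i j : (1 <= i <= j)%N ->
  (forall v, (1 <= v <= j)%N -> GRing.zmod_morphism (Sbar v)) ->
  GRing.zmod_morphism (E i j).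
Proof.
move=> i_bd Sbar_add; have [d] := ubnP (j - i)%N.
elim: d i i_bd => // d IHd i /andP[i_gt0]; rewrite leq_eqVlt.
case: eqVneq => [<- _ _ | _ /= lt_ij le_d]; first by rewrite E_diag.
rewrite E_rec ?i_gt0 //; apply/zmod_morphism_opp_fun/zmod_morphism_comp.
  apply: SinvP_zmod_morphism => //; apply: S_zmod_morphism => //.
  by apply: Sbar_add; rewrite i_gt0 ltnW.
apply: zmod_morphism_sum => v; rewrite mem_index_iota ltnS => /andP[lt_iv le_vj] _.
have v_gt0 : (0 < v)%N := leq_trans (ltn0Sn i) lt_iv.
apply: zmod_morphism_comp; first by apply: Sbar_add; rewrite v_gt0.
apply: IHd; first by rewrite v_gt0.
exact: leq_trans (ltn_sub2l lt_ij lt_iv) le_d.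
Qed.

Lemma M_zmod_morphism i j : (1 <= i <= j)%N ->
  (forall v, (1 <= v <= j)%N -> GRing.zmod_morphism (Sbar v)) ->
  GRing.zmod_morphism (M i j).
Proof.
elim: i j => // -[_|i IHi] j i_bd Sbar_add.
  by rewrite M_first //; apply: E_zmod_morphism.
rewrite M_rec //; apply: zmod_morphism_sum => v.
rewrite mem_index_iota => /andP[]; case: v => // v; rewrite !ltnS => le_iv le_vj _.
apply: zmod_morphism_comp; last by apply: E_zmod_morphism.
apply: IHi => [|u /andP[u_gt0 le_uv]]; first by rewrite /= le_iv.
by apply: Sbar_add; rewrite u_gt0 (leq_trans le_uv) // ltnW.
Qed.

Lemma Sbar_zmod_morphism j : (0 < j)%N -> GRing.zmod_morphism (Sbar j).
Proof.
elim/ltn_ind: j => -[//|[_ _|j IHj _]].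
  by rewrite Sbar_init => x y; rewrite linearB.
rewrite Sbar_rec //; apply: zmod_morphism_sum => i.
rewrite mem_index_iota => i_bd _; apply: zmod_morphism_comp.
  by move=> x y; rewrite linearB.
by apply: M_zmod_morphism => // v /andP[v_gt0 le_vj]; apply: IHj.
Qed.

(* Subtracting the [R i]-component through [E i j] only creates new components
   in [R 1 + ... + R i.-1], because [Sbar i] and [S i] agree modulo these. *)
Lemma SbarE_tail i j x : (1 <= i <= j)%N -> exists r : nat -> Bbar,
  (forall l, (1 <= l < i)%N -> R l (r l)) /\
  \sum_(i <= v < j.+1) Sbar v (E v j x) = S j x + \sum_(1 <= l < i) r l.
Proof.
have [d] := ubnP (j - i)%N.
elim: d i => // d IHd i le_d /andP[i_gt0]; rewrite leq_eqVlt.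
case: eqVneq => [<- _ | _ /= lt_ij].
  rewrite big_nat1 E_diag //.
  exists (fun l => P l (Sbar i x)); split; last exact: Sbar_split.
  by move=> l /andP[l_gt0 _]; apply: P_in_R.
have [||r [Rr tail]] := IHd i.+1; rewrite ?lt_ij //.
  exact: leq_trans (ltn_sub2l lt_ij (ltnSn i)) le_d.
have Rri : R i (r i) by apply: Rr; rewrite i_gt0 /=.
have Pi_tail : P i (\sum_(i.+1 <= v < j.+1) Sbar v (E v j x)) = r i.
  rewrite tail addrC P_sum ?i_gt0 /= //.
  apply: (@Rc_mono _ j.-1); last exact/S_in_Rc/(leq_trans _ lt_ij).
  by rewrite -ltnS (ltn_predK lt_ij).
have Eij : E i j x = - Sinv i (r i).
  by rewrite E_rec ?i_gt0 // opprfctE /= -[in RHS]Pi_tail fct_sumE.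
have [_ S_Sinv] := Sinv_inv i_gt0 Rri.
exists (fun l => r l - P l (Sbar i (Sinv i (r i)))); split.
  move=> l /andP[l_gt0 lt_li]; apply: RB => //; last exact: P_in_R.
  by apply: Rr; rewrite l_gt0 ltnW.
rewrite big_ltn 1?ltnW // tail Eij zmod_morphismN; last exact: Sbar_zmod_morphism.
rewrite [in LHS]Sbar_split // S_Sinv big_nat_recr //= sumrB.
set p := \sum_(1 <= _ < i) P _ _; set q := \sum_(1 <= l < i) r l.
by rewrite [LHS]addrC -addrA; congr (_ + _); rewrite opprD addrA addrK.
Qed.

Lemma sum_SbarE j x : (0 < j)%N -> \sum_(1 <= v < j.+1) Sbar v (E v j x) = S j x.
Proof.
move=> j_gt0; have [|r [_ ->]] := @SbarE_tail 1 j x; first exact: j_gt0.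
by rewrite big_geq // addr0.
Qed.

Lemma sum_LM j x : (0 < j)%N ->
  \sum_(1 <= i < j.+1) L i.-1 (M i j x) =
  \sum_(1 <= v < j.+1) Sbar v (E v j x).
Proof.
move=> j_gt0; rewrite big_ltn // [in RHS]big_ltn // M_first // Sbar_init.
congr (_ + _).
have L_M i : (2 <= i < j.+1)%N -> L i.-1 (M i j x) =
    \sum_(2 <= v < j.+1 | (i <= v)%N) L i.-1 (M i.-1 v.-1 (E v j x)).
  move=> /andP[i_gt1 le_ij]; rewrite M_rec ?i_gt1 // fct_sumE linear_sum.
  by rewrite (big_nat_widenl _ 2).
rewrite (eq_big_nat _ _ L_M) (exchange_big_dep xpredT) //=.
apply: eq_big_nat => -[//|v] /andP[v_gt1 lt_vj].
rewrite Sbar_rec // fct_sumE.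
transitivity (\sum_(2 <= i < v.+2) L i.-1 (M i.-1 v (E v.+1 j x))).
  by rewrite [RHS](big_nat_widen _ _ j.+1).
by rewrite big_add1.
Qed.

End Recursion.

Unset Implicit Arguments.

Theorem lemma2 (F : realType) (kind : scalar_kind)
    (B Bbar : lmodType (scalars F kind))
    (L : nat -> {linear B -> Bbar})
    (L_neq0 : exists i b, L i b != 0)
    (rec : recursion L) (k : nat) :
  oprow_mul (\row_(i < k.+1) (L i : B -> Bbar)) (upper_mx k.+1 (M_ rec))
    = oprow_mul (oprow k.+1 (Sbar_ rec)) (upper_mx k.+1 (E_ rec))
  /\ oprow_mul (oprow k.+1 (Sbar_ rec)) (upper_mx k.+1 (E_ rec))
    = oprow k.+1 (S_ rec).
Proof.
have SbarE : oprow_mul (oprow k.+1 (Sbar_ rec)) (upper_mx k.+1 (E_ rec))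
    = oprow k.+1 (S_ rec).
  apply/rowP => j; apply/funext => x; rewrite oprow_mul_upper_mx => [|i].
    by rewrite sum_SbarE // mxE.
  exact/zmod_morphism0/Sbar_zmod_morphism.
split=> //; apply/rowP => j; apply/funext => x.
rewrite SbarE [in RHS]mxE -sum_SbarE // -sum_LM //.
rewrite (@oprow_mul_upper_mx _ _ _ (fun i => L i.-1)) // => i.
exact: linear0.
Qed.
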